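(* Let $\mathbb{H}_1,\mathbb{H}_2$ be complex Hilbert spaces and let $T=\begin{pmatrix}A&B\\0&0\end{pmatrix}$ on $\mathbb{H}_1\oplus\mathbb{H}_2$, where $A\in B(\mathbb{H}_1)$ and $B\in B(\mathbb{H}_2,\mathbb{H}_1)$. Then $$w(T)\leq\sqrt{2w^2(A)+\frac12\left(\|A^*B\|+\|B\|^2\right)}.$$
   Context: $B(\mathbb{H}_2,\mathbb{H}_1)$ denotes the bounded linear operators from $\mathbb{H}_2$ to $\mathbb{H}_1$, and $B(\mathbb{H}_1)=B(\mathbb{H}_1,\mathbb{H}_1)$; $\|\cdot\|$ on operators is the operator norm. For a bounded operator $S$ on a complex Hilbert space $\mathbb{H}$, the numerical radius is $w(S)=\sup\{|\langle Sx,x\rangle| : x\in\mathbb{H}, \|x\|=1\}$, and $w^2(S)=(w(S))^2$. The direct sum is the Hilbert space direct sum. *)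

(* Defs.v *)
From HB Require Import structures.
From mathcomp Require Import all_boot all_order all_algebra sesquilinear.
From mathcomp Require Import complex ring lra.
From mathcomp Require Import all_classical all_reals all_analysis.

Set Implicit Arguments.
Unset Strict Implicit.
Unset Printing Implicit Defensive.

Import Order.TTheory GRing.Theory Num.Theory.
Import numFieldNormedType.Exports.

Local Open Scope classical_set_scope.
Local Open Scope ring_scope.

(* {dot H for conj} is linear in the first argument, conjugate-linear in the
   second, hermitian and positive definite. *)
HB.mixin Record NormedModule_isPreHilbert (C : numClosedFieldType) H
    & NormedModule C H := {
  inner : {dot H for (@Num.conj C)};
  inner_norm : forall x : H, inner x x = `|x| ^+ 2
}.

#[short(type="hilbertType")]
HB.structure Definition Hilbert (C : numClosedFieldType) :=
  {H of CompleteNormedModule C H & NormedModule_isPreHilbert C H}.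

Notation "'[ u , v ]" := (inner u v) : ring_scope.

Section DotTheory.
Variables (C : numClosedFieldType) (U : lmodType C).
Variable form : {dot U for (@Num.conj C)}.

Lemma dot_CauchySchwarz (u v : U) :
  `|form u v| ^+ 2 <= form u u * form v v.
Proof.
have [->|v0] := eqVneq v 0; first by rewrite !linear0r normr0 expr0n.
have vgt0 : 0 < form v v by rewrite dnorm_gt0.
pose a := form u v / form v v; pose u1 := u - a *: v.
have ou : form u1 v = 0.
  by rewrite linearBl/= linearZl_LR/= divfK ?gt_eqF// subrr.
have -> : u = u1 + a *: v by rewrite subrK.
rewrite [X in `|X|]linearDl /= ou add0r linearZl_LR/= normrM.
rewrite (gtr0_norm vgt0) hnormDd/=; last by rewrite linearZr_LR/= ou mulr0.
by rewrite dnormZ mulrDl exprMn expr2 [X in X <= _]mulrA lerDr mulr_ge0// dnorm_ge0.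
Qed.

Lemma dot_triangle (u v : U) :
  sqrtC (form (u + v) (u + v)) <= sqrtC (form u u) + sqrtC (form v v).
Proof.
have su := sqrt_dnorm_ge0 form u; have sv := sqrt_dnorm_ge0 form v.
rewrite -(ler_pXn2r (n := 2))// ?nnegrE ?sqrt_dnorm_ge0// ?addr_ge0//.
rewrite sqrrD !sqrtCK dnormD/= [leRHS]addrAC lerD2l.
have -> : form u v + (form u v)^* = 'Re (form u v) *+ 2.
  by rewrite ReE -mulr_natr divfK// pnatr_eq0.
rewrite lerMn2r/= (le_trans (leif_Re_Creal _))//.
rewrite -(ler_pXn2r (n := 2))// ?nnegrE ?mulr_ge0// exprMn !sqrtCK.
exact: dot_CauchySchwarz.
Qed.

End DotTheory.

Section DirectSum.
Variable C : numClosedFieldType.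

(* Hilbert direct sum: the carrier is an alias of the product so that it carries
   the l2 norm rather than the sup norm of the library's product of normed
   modules. *)
Definition hsum (H1 H2 : hilbertType C) : Type := (H1 * H2)%type.

Variables H1 H2 : hilbertType C.

HB.instance Definition _ := GRing.Lmodule.copy (hsum H1 H2) (H1 * H2)%type.

Definition hsum_inner (u v : hsum H1 H2) : C := '[u.1, v.1] + '[u.2, v.2].

Lemma hsum_inner_bilinear :
  bilinear_for *%R ((@Num.conj C) \; *%R) hsum_inner.
Proof.
split=> [w a u v|w a u v]; rewrite /hsum_inner /=.
  by rewrite !linearPl /= mulrDr addrACA.
by rewrite !linearPr /= mulrDr addrACA.
Qed.

HB.instance Definition _ := bilinear_isBilinear.Build C (hsum H1 H2)
  (hsum H1 H2) C *%R ((@Num.conj C) \; *%R) hsum_inner hsum_inner_bilinear.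

Lemma hsum_inner_herm (u v : hsum H1 H2) :
  hsum_inner u v = (-1) ^+ false * Num.conj (hsum_inner v u).
Proof.
rewrite /hsum_inner rmorphD mul1r.
by congr (_ + _); rewrite [LHS]hermC mul1r.
Qed.

HB.instance Definition _ := isHermitianSesquilinear.Build C (hsum H1 H2)
  false (@Num.conj C) hsum_inner hsum_inner_herm.

Lemma hsum_inner_gt0 (u : hsum H1 H2) : u != 0 -> 0 < hsum_inner u u.
Proof.
case: u => x y; rewrite -[0]/((0 : H1), (0 : H2)) xpair_eqE negb_and.
rewrite /hsum_inner /= => /orP[x0|y0].
  by apply: ltr_wpDr; rewrite ?dnorm_gt0 // dnorm_ge0.
by apply: ltr_wpDl; rewrite ?dnorm_gt0 // dnorm_ge0.
Qed.

HB.instance Definition _ :=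
  isDotProduct.Build C (hsum H1 H2) hsum_inner hsum_inner_gt0.

Definition hsum_norm (u : hsum H1 H2) : C := sqrtC (hsum_inner u u).

Lemma hsum_normZ (a : C) (u : hsum H1 H2) :
  hsum_norm (a *: u) = `|a| * hsum_norm u.
Proof.
rewrite /hsum_norm dnormZ sqrtCM ?nnegrE ?exprn_ge0 ?dnorm_ge0//.
by rewrite sqrCK.
Qed.

Lemma hsum_norm_eq0 (u : hsum H1 H2) : hsum_norm u = 0 -> u = 0.
Proof. by move/eqP; rewrite sqrt_dnorm_eq0 => /eqP. Qed.

HB.instance Definition _ := Lmodule_isNormed.Build C (hsum H1 H2)
  (dot_triangle hsum_inner) hsum_normZ hsum_norm_eq0.

Lemma hsum_normE (u : hsum H1 H2) :
  `|u| = sqrtC (`|u.1| ^+ 2 + `|u.2| ^+ 2).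
Proof. by rewrite -!inner_norm. Qed.

Lemma hsum_norm_ge1 (u : hsum H1 H2) : `|u.1| <= `|u|.
Proof.
rewrite hsum_normE -{1}(sqrCK (normr_ge0 u.1)).
by rewrite ler_sqrtC ?nnegrE ?addr_ge0 ?exprn_ge0// lerDl exprn_ge0.
Qed.

Lemma hsum_norm_ge2 (u : hsum H1 H2) : `|u.2| <= `|u|.
Proof.
rewrite hsum_normE -{1}(sqrCK (normr_ge0 u.2)).
by rewrite ler_sqrtC ?nnegrE ?addr_ge0 ?exprn_ge0// lerDr exprn_ge0.
Qed.

Lemma hsum_norm_leD (u : hsum H1 H2) : `|u| <= `|u.1| + `|u.2|.
Proof.
rewrite hsum_normE -[leRHS]sqrCK ?addr_ge0//.
rewrite ler_sqrtC ?nnegrE ?addr_ge0 ?exprn_ge0 ?addr_ge0//.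
by rewrite sqrrD [leRHS]addrAC lerDl mulrn_wge0// mulr_ge0.
Qed.

Lemma hsum_complete (F : set_system (hsum H1 H2)) :
  ProperFilter F -> cauchy F -> cvg F.
Proof.
move=> FF /cauchy_ballP Fc.
have c1 : cvg ((fun u : hsum H1 H2 => u.1) @ F).
  apply: cauchy_cvg; apply/cauchy_ballP => e e0; rewrite near_simpl.
  apply: filterS (Fc e e0) => -[u v]; rewrite -!ball_normE/=.
  exact: (le_lt_trans (hsum_norm_ge1 (u - v))).
have c2 : cvg ((fun u : hsum H1 H2 => u.2) @ F).
  apply: cauchy_cvg; apply/cauchy_ballP => e e0; rewrite near_simpl.
  apply: filterS (Fc e e0) => -[u v]; rewrite -!ball_normE/=.
  exact: (le_lt_trans (hsum_norm_ge2 (u - v))).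
pose l : hsum H1 H2 := (lim ((fun u : hsum H1 H2 => u.1) @ F),
                        lim ((fun u : hsum H1 H2 => u.2) @ F)).
apply/cvg_ex; exists l; apply/cvgrPdist_lt => e e0.
have e20 : 0 < e / 2 by rewrite divr_gt0.
have d1 := cvgr_dist_lt _ _ c1 _ e20; have d2 := cvgr_dist_lt _ _ c2 _ e20.
near=> u; rewrite (le_lt_trans (hsum_norm_leD _))//=.
rewrite (splitr e) ltrD//; near: u; [exact: d1|exact: d2].
Unshelve. all: by end_near. Qed.

HB.instance Definition _ :=
  Uniform_isComplete.Build (hsum H1 H2) hsum_complete.

Lemma hsum_inner_norm (u : hsum H1 H2) : hsum_inner u u = `|u| ^+ 2.
Proof. by rewrite sqrtCK. Qed.

HB.instance Definition _ := NormedModule_isPreHilbert.Build C (hsum H1 H2)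
  hsum_inner_norm.

Lemma hsum_innerE (u v : hsum H1 H2) :
  '[u, v] = '[u.1, v.1] + '[u.2, v.2].
Proof. by []. Qed.

End DirectSum.

Local Notation Re := complex.Re.
Local Notation "x %:C" := (real_complex _ x) : ring_scope.

Section Operators.
Variable R : realType.

(* Norms take their values in R[i]; `u <= v` in R[i] entails that v - u is real. *)
Definition bounded_op (H1 H2 : hilbertType R[i]) (S : H1 -> H2) :=
  exists M : R[i], forall x, `|S x| <= M * `|x|.

Definition opnorm (H1 H2 : hilbertType R[i]) (S : H1 -> H2) : R :=
  sup [set Re `|S x| | x in [set x | `|x| <= 1]].

(* On the zero space the set is empty and the value is sup set0 = 0. *)
Definition numerical_radius (H : hilbertType R[i]) (S : H -> H) : R :=
  sup [set Re `|'[S x, x]| | x in [set x | `|x| = 1]].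

(* The default value 0 is never used for bounded linear S, see adjointP. *)
Definition adjoint (H1 H2 : hilbertType R[i]) (S : H1 -> H2) (y : H2) : H1 :=
  xget 0 [set z | forall x, '[S x, y] = '[x, z]].

(* The operator matrix (A B; C D). *)
Definition block_op (H1 H2 : hilbertType R[i])
    (A : H1 -> H1) (B : H2 -> H1) (C : H1 -> H2) (D : H2 -> H2) :
    hsum H1 H2 -> hsum H1 H2 :=
  fun u => (A u.1 + B u.2, C u.1 + D u.2).

End Operators.

Section Riesz.
Variables (R : realType) (H : hilbertType R[i]).

Let N (x : H) : R := Re `|x|.

Let normN (x : H) : `|x| = (N x)%:C.
Proof. by rewrite RRe_real// ger0_real. Qed.

Let N_ge0 x : 0 <= N x.
Proof. by have := normr_ge0 x; rewrite normN -lecR. Qed.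

Let innerN x : '[x, x] = (N x ^+ 2)%:C.
Proof. by rewrite inner_norm normN -rmorphXn. Qed.

Let N_triangle x y : N (x + y) <= N x + N y.
Proof. by rewrite -lecR rmorphD /= -!normN ler_normD.
Qed.

Let parallelogram x y :
  N (x - y) ^+ 2 + N (x + y) ^+ 2 = N x ^+ 2 + N y ^+ 2 + (N x ^+ 2 + N y ^+ 2).
Proof.
apply: (@complexI R).
have : '[x - y, x - y] + '[x + y, x + y] = '[x, x] + '[y, y] + ('[x, x] + '[y, y]).
  by rewrite dnormB dnormD /=; ring.
by rewrite !innerN -!rmorphD.
Qed.

Lemma riesz_ex (phi : {scalar H}) (M : R[i]) :
  (forall x, `|phi x| <= M * `|x|) -> exists z, forall x, phi x = '[x, z].
Proof.
move=> bd.
have [[x0 phix0]|phi0] := pselect (exists x, phi x != 0); last first.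
  exists 0 => x; rewrite linear0r; apply/eqP/negPn/negP => px.
  by apply: phi0; exists x.
pose S := [set N x ^+ 2 | x in [set x | phi x = 1]].
have S0 : S !=set0.
  exists (N ((phi x0)^-1 *: x0) ^+ 2); exists ((phi x0)^-1 *: x0) => //=.
  by rewrite linearZ/= mulVf.
have lbS : has_lbound S by exists 0 => _ [x _ <-]; rewrite exprn_ge0.
pose d := inf S.
have dle x : phi x = 1 -> d <= N x ^+ 2.
  by move=> px; apply: ge_inf => //; exists x.
pose E e := [set x | phi x = 1 /\ N x ^+ 2 < d + e].
have Ene e : 0 < e -> E e !=set0.
  by move=> e0; have [_ [x px <-] xe] := inf_adherent e0 (conj S0 lbS); exists x.
pose F := [set A | exists2 e : R, 0 < e & E e `<=` A].
have FE e : 0 < e -> F (E e) by move=> e0; exists e.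
have FF : ProperFilter F.
  apply: Build_ProperFilter_ex.
    by move=> A [e e0 EA]; have [x /EA] := Ene _ e0; exists x.
  split.
  - by exists 1.
  - move=> A B [e e0 EA] [f f0 EB]; exists (Num.min e f).
      by rewrite lt_min e0.
    move=> x [px xlt]; split.
      by apply: EA; split => //; rewrite (lt_le_trans xlt)// lerD2l ge_min lexx.
    by apply: EB; split => //; rewrite (lt_le_trans xlt)// lerD2l ge_min lexx orbT.
  - by move=> A B AB [e e0 EA]; exists e => //; exact: subset_trans EA AB.
have Ediam e x y : E e x -> E e y -> N (x - y) ^+ 2 <= 4 * e.
  move=> [px xe] [py ye]; have h1 := parallelogram x y.
  pose w := 2^-1 *: (x + y).
  have h2 := parallelogram w w.
  have ww : w + w = x + y.
    by rewrite -scalerDl -[2^-1]mul1r -splitr scale1r.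
  have h3 : d <= N w ^+ 2.
    apply: dle; rewrite linearZ linearD /= px py.
    by rewrite -[1 + 1]/(2%:R) mulVf// pnatr_eq0.
  rewrite subrr ww [N 0](_ : _ = 0) ?expr0n/= in h2; last by rewrite /N normr0.
  lra.
have Fc : cauchy F.
  apply/cauchy_ballP => e e0.
  pose r := Re e.
  have er : e = r%:C by rewrite RRe_real// gtr0_real.
  have r0 : 0 < r by rewrite -ltcR -er; exact: e0.
  have r8 : 0 < r ^+ 2 / 8 by rewrite divr_gt0// exprn_gt0.
  exists (E (r ^+ 2 / 8), E (r ^+ 2 / 8)); first by split; exact: FE.
  move=> -[x y] /= [Ex Ey]; rewrite -ball_normE/= normN er ltcR.
  have h := Ediam _ _ _ Ex Ey.
  rewrite -(ltr_pXn2r (n := 2)) ?nnegrE ?N_ge0 ?(ltW r0)//.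
  by have := exprn_gt0 2 r0; lra.
have Fl := @cauchy_cvg _ F FF Fc; set l := lim F in Fl.
have approx e : 0 < e -> exists2 x, E e x & N (l - x) < e.
  move=> e0.
  have e0C : 0 < e%:C :> R[i] by rewrite ltcR.
  have Fb := Fl _ (nbhsx_ballx l _ e0C); rewrite -ball_normE in Fb.
  have [x [/= xl Ex]] := filter_ex (filterI Fb (FE _ e0)).
  by exists x => //; rewrite -ltcR -normN.
have pl : phi l = 1.
  apply/eqP; rewrite -subr_eq0 -normr_le0.
  pose m := Re `|M|.
  have mE : `|M| = m%:C by rewrite RRe_real// ger0_real.
  have m0 : 0 <= m by rewrite -lecR -mE; exact: normr_ge0.
  pose a := Re `|phi l - 1|.
  have aE : `|phi l - 1| = a%:C by rewrite RRe_real// ger0_real.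
  rewrite aE lecR; apply/ler_addgt0Pl => e e0; rewrite addr0.
  have [x [px _] xl] : exists2 x, E (e / (m + 1)) x & N (l - x) < e / (m + 1).
    by apply: approx; rewrite divr_gt0// ltr_wpDl.
  have : a <= m * N (l - x).
    rewrite -lecR -aE -px -linearB.
    have -> : (m * N (l - x))%:C = `|M| * `|l - x| by rewrite rmorphM mE normN.
    have h := bd (l - x); have v0 := le_trans (normr_ge0 _) h.
    by rewrite -(ger0_norm v0) normrM normr_id in h.
  move/le_trans; apply.
  rewrite (@le_trans _ _ (m * (e / (m + 1))))//; first by rewrite ler_wpM2l// ltW.
  by rewrite mulrA ler_pdivrMr ?ltr_wpDl// mulrC ler_pM2l// lerDl.
have Nl : N l ^+ 2 <= d.
  have d0 : 0 <= d by apply: lb_le_inf => // _ [x _ <-]; rewrite exprn_ge0.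
  apply/ler_addgt0Pr => e e0.
  pose c := 2 * d + 6.
  have c0 : 0 < c by rewrite /c; lra.
  pose f := Num.min 1 (e / c).
  have f0 : 0 < f by rewrite lt_min ltr01 divr_gt0.
  have f1 : f <= 1 by rewrite ge_min lexx.
  have fe : f * c <= e by rewrite -ler_pdivlMr// ge_min lexx orbT.
  have [x [px xf] xl] := approx _ f0.
  have Nle : N l <= N x + N (l - x) by rewrite -{1}(subrK x l) addrC N_triangle.
  have L0 := N_ge0 l; have p0 := N_ge0 x; have q0 := N_ge0 (l - x).
  have h1 : N l ^+ 2 <= (N x + N (l - x)) ^+ 2 by rewrite lerXn2r ?nnegrE ?addr_ge0.
  have h2 : N x <= d + 2 by have := sqr_ge0 (N x - 1); nra.
  have h3 : N x * N (l - x) <= (d + 2) * f by rewrite ler_pM// ltW.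
  have h4 : N (l - x) ^+ 2 <= f * 1 by rewrite expr2 ler_pM// ?(le_trans (ltW xl))// ltW.
  rewrite /c in fe; nra.
have ker n : phi n = 0 -> '[n, l] = 0.
  move=> pn; have [->|n0] := eqVneq n 0; first by rewrite linear0l.
  have nn : 0 < '[n, n] by rewrite dnorm_gt0.
  pose t := '[l, n] / '[n, n].
  have : '[l, l] <= '[l - t *: n, l - t *: n].
    rewrite !innerN lecR (le_trans Nl)// dle// linearB linearZ/= pn pl.
    by rewrite mulr0 subr0.
  have o : '[l - t *: n, t *: n] = 0.
    rewrite linearZr_LR/= linearBl/= linearZl_LR/= divfK ?gt_eqF//.
    by rewrite subrr mulr0.
  rewrite -[in X in X <= _](subrK (t *: n) l) hnormDd//=.
  rewrite gerDl dnormZ pmulr_lle0// => h.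
  have : t = 0 by apply/eqP; rewrite -normr_eq0 -sqrf_eq0 eq_le h exprn_ge0.
  move/eqP; rewrite /t mulf_eq0 invr_eq0 (gt_eqF nn) orbF => /eqP ln.
  by rewrite [LHS]hermC mul1r/= ln rmorph0.
have l0 : '[l, l] != 0.
  rewrite dnorm_eq0; apply/eqP => l0; move: pl; rewrite l0 linear0 => /eqP.
  by rewrite eq_sym oner_eq0.
exists ('[l, l]^-1 *: l) => x.
have : '[x - phi x *: l, l] = 0.
  by apply: ker; rewrite linearB linearZ/= pl mulr1 subrr.
rewrite linearBl/= linearZl_LR/= => /eqP; rewrite subr_eq0 => /eqP xl.
have rl : '[l, l]^-1 \is Num.real by rewrite rpredV ger0_real// dnorm_ge0.
by rewrite linearZr_LR/= xl (conj_Creal rl) mulrCA mulVf// mulr1.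
Qed.

End Riesz.

Section Adjoint.
Variables (R : realType) (H1 H2 : hilbertType R[i]).
Variable S : {linear H1 -> H2}.

Lemma adjointP (bS : bounded_op S) x y : '[S x, y] = '[x, adjoint S y].
Proof.
rewrite /adjoint; case: xgetP => [z _ ->//|noz]; exfalso.
have lin : scalar (fun x => '[S x, y]).
  by move=> a u v; rewrite linearP linearDl /= linearZl_LR.
pose phi : {scalar H1} := HB.pack (fun x => '[S x, y])
  (GRing.isLinear.Build _ _ _ _ _ lin).
have [M SM] := bS.
have [|z zP] := @riesz_ex _ _ phi (M * `|y|).
  move=> u /=; rewrite mulrAC (@le_trans _ _ (`|S u| * `|y|))//; last first.
    by rewrite ler_wpM2r.
  rewrite -(ler_pXn2r (n := 2)) ?nnegrE ?mulr_ge0// exprMn -!inner_norm.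
  exact: dot_CauchySchwarz.
exact: (noz z).
Qed.

End Adjoint.

(* Main.v *)
(* With u = (x, y) of norm 1, <Tu, u> = <Ax, x> + <By, x>, hence
   |<Tu, u>|^2 <= 2 |<Ax, x>|^2 + 2 |<By, x>|^2.  Here |<Ax, x>| <= w(A), and
   2 |<By, x>|^2 <= 2 |B|^2 |x|^2 |y|^2 <= |B|^2 / 2 because |x|^2 + |y|^2 = 1.
   The term |A^* B| only contributes through its nonnegativity. *)
Require Import Defs.
From mathcomp Require Import all_boot all_order all_algebra.
From mathcomp Require Import complex.
From mathcomp Require Import all_classical all_reals all_analysis.
From mathcomp Require Import sesquilinear ring lra.

Import Order.TTheory GRing.Theory Num.Theory.

Local Open Scope ring_scope.

Local Notation Re := complex.Re.
Local Notation "x %:C" := (real_complex _ x) : ring_scope.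

Lemma inner_CauchySchwarz (C : numClosedFieldType) (H : hilbertType C)
    (u v : H) : `|inner u v| <= `|u| * `|v|.
Proof.
rewrite -(ler_pXn2r (n := 2)) ?nnegrE ?mulr_ge0// exprMn -!inner_norm.
exact: dot_CauchySchwarz.
Qed.

(** Bridge between the two codomains: norms live in [R[i]], while [opnorm] and [numerical_radius]
    are real suprema. Inequalities pass across it by [lecR]. *)
Lemma normRe {R : realType} {V : normedZmodType R[i]} (x : V) :
  `|x| = (Re `|x|)%:C.
Proof. by rewrite RRe_real// ger0_real. Qed.

Lemma Re_norm_ge0 {R : realType} {V : normedZmodType R[i]} (x : V) :
  0 <= Re `|x|.
Proof. by rewrite -lecR -normRe normr_ge0. Qed.

Lemma sup_ge0 (R : realType) (E : set R) :
  (forall e, E e -> 0 <= e) -> 0 <= sup E.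
Proof.
(* When [E] is empty or unbounded above, [sup E] is 0 by convention. *)
move=> E0; have [supE|/sup_out->//] := pselect (has_sup E).
have [e Ee] := supE.1.
by apply: le_trans (E0 _ Ee) _; apply: ub_le_sup => //; exact: supE.2.
Qed.

Lemma opnorm_ge0 (R : realType) (H1 H2 : hilbertType R[i]) (S : H1 -> H2) :
  0 <= opnorm S.
Proof. by apply: sup_ge0 => _ [x _ <-]; exact: Re_norm_ge0. Qed.

Lemma bounded_opP {R : realType} {H1 H2 : hilbertType R[i]} {S : H1 -> H2} :
  bounded_op S -> exists2 m : R, 0 <= m & forall x, Re `|S x| <= m * Re `|x|.
Proof.
move=> [M SM]; exists (Re `|M|); first exact: (@Re_norm_ge0 _ R[i]).
move=> x; rewrite -lecR rmorphM /= -!normRe -(@normRe _ R[i]).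
(* [M] is complex, but [M * |x|] dominates a norm, so it is nonnegative and equals its own modulus
   [|M| * |x|]. *)
have h := SM x; have v0 := le_trans (normr_ge0 _) h.
by rewrite -(ger0_norm v0) normrM normr_id in h.
Qed.

Lemma opnorm_le (R : realType) (H1 H2 : hilbertType R[i])
    (S : {linear H1 -> H2}) (x : H1) :
  bounded_op S -> Re `|S x| <= opnorm S * Re `|x|.
Proof.
move=> /bounded_opP[m m0 Sm].
have [->|x0] := eqVneq x 0; first by rewrite linear0 !normr0 mulr0.
have nx : 0 < Re `|x| by rewrite -ltcR -normRe normr_gt0.
(* The quotient of [|S x|] by [|x|] is the value of [|S _|] at the normalized vector; [m] bounds all
   such values, so the supremum is genuine. *)
rewrite -ler_pdivrMr//; apply: ub_le_sup.
  exists m => _ [y /= y1 <-]; apply: le_trans (Sm y) _.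
  by rewrite ler_piMr// -lecR -normRe rmorph1.
exists (`|x|^-1 *: x) => /=.
  by rewrite /= normrZ normfV normr_id mulVf// normr_eq0.
rewrite linearZ normrZ normfV normr_id (normRe x) (normRe (S x)).
by rewrite -fmorphV -rmorphM /= mulrC.
Qed.

Lemma numerical_radius_le (R : realType) (H : hilbertType R[i])
    (S : {linear H -> H}) (x : H) :
  bounded_op S -> Re `|inner (S x) x| <= numerical_radius S * Re `|x| ^+ 2.
Proof.
move=> /bounded_opP[m m0 Sm].
have [->|x0] := eqVneq x 0.
  by rewrite linear0r !normr0 expr0n mulr0.
have nx : 0 < Re `|x| by rewrite -ltcR -normRe normr_gt0.
rewrite -ler_pdivrMr ?exprn_gt0//; apply: ub_le_sup.
  (* On the unit sphere, Cauchy-Schwarz bounds the quadratic form by [|S y|], hence by [m]. *)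
  exists m => _ [y /= y1 <-]; apply: le_trans (_ : Re `|S y| <= _).
    rewrite -lecR -normRe -(@normRe _ R[i]).
    by apply: le_trans (inner_CauchySchwarz _ _ _ _) _; rewrite y1 mulr1.
  by have := Sm y; rewrite y1 mulr1.
(* Normalizing [x] scales the form by [c^* * c], whose modulus is the inverse square of [|x|]. *)
set c := `|x|^-1; exists (c *: x).
  by rewrite /= normrZ normfV normr_id mulVf// normr_eq0.
have -> : inner (S (c *: x)) (c *: x) = c^* * (c * inner (S x) x).
  by rewrite linearZr_LR /= [S _]linearZ linearZl_LR.
rewrite !normrM norm_conjC /c !normfV !normr_id.
rewrite (normRe x) (@normRe _ R[i] (inner _ _)) -!fmorphV -!rmorphM /=.
by field; rewrite gt_eqF.
Qed.

Theorem theorem3p7 (R : realType) (H1 H2 : hilbertType R[i])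
    (A : {linear H1 -> H1}) (B : {linear H2 -> H1})
    (bdA : bounded_op A) (bdB : bounded_op B) :
  numerical_radius (block_op A B \0 \0) <=
    Num.sqrt (2 * numerical_radius A ^+ 2
              + 2^-1 * (opnorm (adjoint A \o B) + opnorm B ^+ 2)).
Proof.
set E := (X in Num.sqrt X).
rewrite /numerical_radius; set W := [set _ | _ in _]%classic.
(* If the direct sum has no unit vector, the supremum is 0 by convention. *)
have [->|W0] := eqVneq W set0; first by rewrite sup0 sqrtr_ge0.
apply: ge_sup; first exact/set0P.
move=> _ [[x y] u1 <-].
have xy1 : Re `|x| ^+ 2 + Re `|y| ^+ 2 = 1.
  apply: (@complexI R); rewrite rmorphD !rmorphXn /= -!normRe.
  have := hsum_inner_norm (x, y : H2).
  by rewrite u1 expr1n /hsum_inner /= !inner_norm.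
have -> : inner (block_op A B \0 \0 (x, y)) ((x, y) : hsum H1 H2) =
    inner (A x) x + inner (B y) x.
  by rewrite hsum_innerE /= addr0 linear0l addr0 linearDl.
set s := Re _.
have s0 : 0 <= s by exact: (@Re_norm_ge0 _ R[i]).
have spq : s <= Re `|inner (A x) x| + Re `|inner (B y) x|.
  by rewrite -lecR rmorphD /= -!(@normRe _ R[i]) ler_normD.
have pw := numerical_radius_le _ _ _ x bdA.
have qB : Re `|inner (B y) x| <= opnorm B * Re `|y| * Re `|x|.
  apply: (@le_trans _ _ (Re `|B y| * Re `|x|)).
    rewrite -lecR rmorphM /= -!normRe -(@normRe _ R[i]).
    exact: inner_CauchySchwarz.
  by rewrite ler_wpM2r ?Re_norm_ge0// opnorm_le.
have p0 : 0 <= Re `|inner (A x) x| by exact: (@Re_norm_ge0 _ R[i]).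
have q0 : 0 <= Re `|inner (B y) x| by exact: (@Re_norm_ge0 _ R[i]).
have n0 := opnorm_ge0 _ _ _ (adjoint A \o B).
have b0 := opnorm_ge0 _ _ _ B.
have w0 : 0 <= numerical_radius A.
  by apply: sup_ge0 => _ [z _ <-]; exact: (@Re_norm_ge0 _ R[i]).
have x0 := Re_norm_ge0 x; have y0 := Re_norm_ge0 y.
(* Writing [s] as the root of its square reduces the goal to [s ^+ 2 <= E], a statement of real
   arithmetic once the norms are generalized. *)
rewrite -(ger0_norm s0) -sqrtr_sqr ler_wsqrtr// /E.
move: (Re `|x|) (Re `|y|) (Re `|inner (A x) x|) (Re `|inner (B y) x|)
  (numerical_radius A) (opnorm B) (opnorm (adjoint A \o B))
  s0 spq pw qB p0 q0 n0 b0 w0 x0 y0 xy1 => a b p q w n k s0 spq pw qB p0 q0 n0 b0 w0 a0 ? ab1.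
(* Here [p <= w * a ^+ 2 <= w], as [a ^+ 2 <= 1]. *)
have p2 : p ^+ 2 <= w ^+ 2.
  by rewrite lerXn2r ?nnegrE// (le_trans pw)// ler_piMr//; nra.
(* AM-GM with [a ^+ 2 + b ^+ 2 = 1]. *)
have ab : b * a <= 2^-1 by have := sqr_ge0 (a - b); nra.
have q2 : q ^+ 2 <= (n / 2) ^+ 2.
  rewrite lerXn2r ?nnegrE ?divr_ge0// (le_trans qB)// -mulrA.
  by rewrite ler_wpM2l.
have s2 : s ^+ 2 <= (p + q) ^+ 2 by rewrite lerXn2r ?nnegrE ?addr_ge0.
(* The square of [p - q] gives [(p + q) ^+ 2 <= 2 * p ^+ 2 + 2 * q ^+ 2], and [2 * q ^+ 2] is at
   most half of [n ^+ 2]. *)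
by have := sqr_ge0 (p - q); nra.
Qed.
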